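(* Let $K\subset\mathbb{H}^2$ be a convex body, containing the origin $O$ in its interior, such that $\partial K$ is a $C^1$-smooth curve. Suppose there are constants $c_1,c_2$ such that for every geodesic $\Gamma$ passing through $O$ the section $K\cap\Gamma$ has length $c_1$ and the projection $P_\Gamma(K)$ has length $c_2$. Then $K$ is a disc, and $c_1=c_2$.
   Context: $\mathbb{H}^2$ is the hyperbolic plane and $O\in\mathbb{H}^2$ is a fixed point, called the origin (e.g. the center of the Poincaré disc model). A body is a compact set $K\subset\mathbb{H}^2$ equal to the closure of its non-empty interior. It is convex if its boundary cannot be intersected by a geodesic in more than two points (with the exception that an arc of a geodesic may be part of the boundary). A disc is a closed hyperbolic metric ball of positive radius. For a geodesic (complete line) $\Gamma$ and a point $x\in\mathbb{H}^2$, $n_\Gamma(x)$ denotes the geodesic through $x$ perpendicular to $\Gamma$. The projection of $K$ onto $\Gamma$ is $P_\Gamma(K)=\{x\in\Gamma : K\cap n_\Gamma(x)\neq\emptyset\}$, a geodesic segment. Lengths are hyperbolic lengths of geodesic segments. *)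

(* Defs.v *)
(* The hyperbolic plane is the Poincare disc model, i.e. the
   open unit disc of [R * R] with the metric of curvature -1.  Its topology and
   its C^1 structure are those induced by [R * R]; as the bodies considered are
   compact subsets of the open disc, closure, interior and boundary computed in
   [R * R] are those of the hyperbolic plane. *)
From HB Require Import structures.
From mathcomp Require Import all_boot all_order all_algebra.
From mathcomp Require Import all_classical all_reals all_analysis.

Set Implicit Arguments.
Unset Strict Implicit.
Unset Printing Implicit Defensive.

Import Order.TTheory GRing.Theory Num.Theory.
Import numFieldNormedType.Exports.

Local Open Scope classical_set_scope.
Local Open Scope ring_scope.

Definition dot (R : realType) (x y : R * R) : R := x.1 * y.1 + x.2 * y.2.

Definition hplane (R : realType) : set (R * R) := [set x | dot x x < 1].

Definition acosh (R : realType) (t : R) : R := ln (t + Num.sqrt (t ^+ 2 - 1)).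

Definition hdist (R : realType) (x y : R * R) : R :=
  acosh (1 + 2 * dot (x - y) (x - y) / ((1 - dot x x) * (1 - dot y y))).

Definition hdisc (R : realType) (c : R * R) (r : R) : set (R * R) :=
  [set x | hplane x /\ hdist c x <= r].

Definition is_disc (R : realType) (K : set (R * R)) : Prop :=
  exists c r, [/\ hplane c, 0 < r & K = hdisc c r].

(* For [a ^+ 2 < dot b b]: if [a = 0], the diameter orthogonal to [b]; otherwise
   the part in the disc of the circle with centre [c = a^-1 *: b] and squared
   radius [dot c c - 1], i.e. of a circle orthogonal to the unit circle. *)
Definition geod (R : realType) (a : R) (b : R * R) : set (R * R) :=
  [set z | hplane z /\ a * (1 + dot z z) = 2 * dot b z].

Definition is_geodesic (R : realType) (G : set (R * R)) : Prop :=
  exists a b, a ^+ 2 < dot b b /\ G = geod a b.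

(* [b - a *: z] is a Euclidean normal vector of [geod a b] at its point [z]; the
   model being conformal, hyperbolic angles are Euclidean angles. *)
Definition perpendicular (R : realType) (G H : set (R * R)) : Prop :=
  exists a b a' b',
    [/\ a ^+ 2 < dot b b, G = geod a b, a' ^+ 2 < dot b' b', H = geod a' b' &
        exists z, [/\ G z, H z &
          dot (b - (a * z.1, a * z.2)) (b' - (a' * z.1, a' * z.2)) = 0]].

(* The geodesic through [x] perpendicular to [G] (it is unique), as a set. *)
Definition normal_geodesic (R : realType) (G : set (R * R)) (x : R * R) :
    set (R * R) :=
  [set y | exists H, [/\ is_geodesic H, H x, perpendicular G H & H y]].

Definition projection (R : realType) (G K : set (R * R)) : set (R * R) :=
  [set x | G x /\ (K `&` normal_geodesic G x) !=set0].

Definition hsegment (R : realType) (p q : R * R) : set (R * R) :=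
  [set x | hplane x /\ hdist p x + hdist x q = hdist p q].

Definition has_length (R : realType) (S : set (R * R)) (l : R) : Prop :=
  exists p q, [/\ hplane p, hplane q, S = hsegment p q & hdist p q = l].

Definition boundary (R : realType) (K : set (R * R)) : set (R * R) :=
  closure K `\` interior K.

Definition is_body (R : realType) (K : set (R * R)) : Prop :=
  [/\ K `<=` @hplane R, compact K, interior K !=set0 &
      K = closure (interior K)].

Definition hconvex (R : realType) (K : set (R * R)) : Prop :=
  forall G, is_geodesic G ->
    (exists p q, boundary K `&` G `<=` [set p; q]) \/
    (exists p q, [/\ hplane p, hplane q & boundary K `&` G = hsegment p q]).

Definition is_C1 (R : realType) (f : R -> R) : Prop :=
  (forall t, derivable f t 1) /\ continuous (derive1 f).

Definition C1_smooth_closed_curve (R : realType) (S : set (R * R)) : Prop :=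
  exists (x y : R -> R) (T : R),
    [/\ 0 < T, is_C1 x, is_C1 y,
        (forall t, (derive1 x t, derive1 y t) <> (0, 0)) &
        [/\ periodic x T, periodic y T,
            (forall s t, 0 <= s < T -> 0 <= t < T ->
               (x s, y s) = (x t, y t) -> s = t) &
            S = range (fun t => (x t, y t))]].

(* Main.v *)
Require Import Defs.
From HB Require Import structures.
From mathcomp Require Import all_boot all_order all_algebra.
From mathcomp Require Import all_classical all_reals all_analysis.
From mathcomp Require Import ring lra.

(** Klein coordinates centred at O turn geodesics into chords of the unit disc,
geodesics through O into diameters, and geodesics perpendicular to a diameter
into Euclidean perpendiculars to it.  On a chord of half-length W the hyperbolic
distance between the points of abscissae s and t is |F s - F t| with
F s = (ln (W + s) - ln (W - s)) / 2.  So for a unit vector u, with W = 1, the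
section of K in the direction u is an interval [a u, b u] with
F (b u) - F (a u) = c1, and its projection is the range [t1 u, t2 u] of the
linear form dot u on K, with F (t2 u) - F (t1 u) = c2; always
t1 u <= a u <= b u <= t2 u.

Let M be the largest Euclidean norm of the coordinates of a point of K, attained
in the direction v, and let m = - a v.  As the sections have constant length,
the point opposite to a farthest one is a nearest boundary point, so the ball of
radius m lies in K ([equichordal_extremes]).  Clearly t2 v = M.  Convexity gives
t1 v = - m: the tangent to the inscribed ball at its contact point with the
boundary supports K, as otherwise a chord would cross the inscribed ball, leave K
on both sides and meet the boundary a third time at the contact point
([nearest_support]).  Hence c2 = F M - F (- m) = c1.

With equal lengths, t1 u <= a u <= b u <= t2 u forces t2 u = b u for all u: K is
supported at every boundary point by the perpendicular to the radius, that is,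
b w * dot w u <= b u for all unit u and w.  As 1 - dot w u is quadratic in the
angle between u and w, the function b varies quadratically in the angle and is
therefore constant ([support_radial_cst]), and K is the disc centred at O of
Euclidean radius M in these coordinates. *)

Set Implicit Arguments.
Unset Strict Implicit.
Unset Printing Implicit Defensive.

Import Order.TTheory GRing.Theory Num.Theory.
Import numFieldNormedType.Exports.

Local Open Scope classical_set_scope.
Local Open Scope ring_scope.

(** * Plane vectors *)

Definition scalev (R : realType) (a : R) (x : R * R) : R * R := (a * x.1, a * x.2).

Definition turn (R : realType) (v : R * R) : R * R := (- v.2, v.1).

Lemma dot_ge0 (R : realType) (x : R * R) : 0 <= dot x x.
Proof. by rewrite /dot -!expr2 addr_ge0 ?sqr_ge0. Qed.

Lemma dot_scalev (R : realType) (a b : R) (x y : R * R) :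
  dot (scalev a x) (scalev b y) = a * b * dot x y.
Proof. by rewrite /dot /scalev /=; ring. Qed.

Lemma cauchy_schwarz (R : realType) (x y : R * R) :
  dot x y ^+ 2 <= dot x x * dot y y.
Proof.
rewrite -subr_ge0 (_ : _ - _ = (x.1 * y.2 - x.2 * y.1) ^+ 2) ?sqr_ge0 //.
rewrite /dot; ring.
Qed.

Lemma dot_turn (R : realType) (v : R * R) : dot (turn v) (turn v) = dot v v.
Proof. by rewrite /dot /turn /=; ring. Qed.

Lemma dot_turnl (R : realType) (v : R * R) : dot (turn v) v = 0.
Proof. by rewrite /dot /turn /=; ring. Qed.

Lemma dotC (R : realType) (x y : R * R) : dot x y = dot y x.
Proof. by rewrite /dot; ring. Qed.

Lemma dotDr (R : realType) (x y z : R * R) : dot x (y + z) = dot x y + dot x z.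
Proof. by rewrite /dot /=; ring. Qed.

Lemma dot_scalevr (R : realType) (a : R) (x y : R * R) : dot x (scalev a y) = a * dot x y.
Proof. by rewrite /dot /scalev /=; ring. Qed.

Lemma sqr_itv (R : realType) (a b : R) : 0 <= b -> a ^+ 2 <= b ^+ 2 -> - b <= a <= b.
Proof.
move=> b0 h; rewrite -ler_norml -[leRHS](ger0_norm b0).
by rewrite -[leLHS]sqrtr_sqr -[leRHS]sqrtr_sqr ler_wsqrtr.
Qed.

Lemma sqr_lt1 (R : realType) (s : R) : -1 < s < 1 -> s ^+ 2 < 1.
Proof. by move=> /andP[h1 h2]; nra. Qed.

Lemma turn_basis (R : realType) (v k : R * R) : dot v v = 1 ->
  k = scalev (dot (turn v) k) (turn v) + scalev (dot v k) v.
Proof.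
case: v k => [v1 v2] [k1 k2]; rewrite /dot /scalev /= => h.
by congr pair => /=; [rewrite -[LHS]mul1r | rewrite -[LHS]mul1r]; rewrite -h; ring.
Qed.

Lemma dot_turn_basis (R : realType) (v k l : R * R) : dot v v = 1 ->
  dot k l = dot (turn v) k * dot (turn v) l + dot v k * dot v l.
Proof.
case: v k l => [v1 v2] [k1 k2] [l1 l2]; rewrite /dot /= => h.
by rewrite -[LHS]mul1r -h; ring.
Qed.

(** The vector (1, 0) serves as direction of the null vector. *)
Lemma polar_decomposition (R : realType) (k : R * R) :
  exists2 v, dot v v = 1 & k = scalev (Num.sqrt (dot k k)) v.
Proof.
have [k0|k0] := eqVneq (dot k k) 0.
  exists (1, 0); first by rewrite /dot /=; ring.
  rewrite k0 sqrtr0 /scalev /= !mul0r; case: k k0 => k1 k2 /eqP.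
  by rewrite /dot /= -!expr2 paddr_eq0 ?sqr_ge0 // !sqrf_eq0 => /andP[/eqP-> /eqP->].
have s0 : Num.sqrt (dot k k) != 0.
  by rewrite sqrtr_eq0 -ltNge lt0r k0 dot_ge0.
exists (scalev (Num.sqrt (dot k k))^-1 k).
  by rewrite dot_scalev -invfM -expr2 sqr_sqrtr ?dot_ge0 // mulVf.
by rewrite /scalev /= !mulrA divff // !mul1r; case: (k).
Qed.

(** * Klein coordinates centred at a point *)

(** The Lorentz form: the first coordinate is the time-like one. *)
Definition mdot (R : realType) (X Y : R * (R * R)) : R :=
  dot X.2 Y.2 - X.1 * Y.1.

(** The Lorentz boost taking the hyperboloid point above O to (1, 0); the
inverse boost is [boost (- O)]. *)
Definition boost (R : realType) (O : R * R) (X : R * (R * R)) : R * (R * R) :=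
  (((1 + dot O O) * X.1 - 2 * dot O X.2) / (1 - dot O O),
   X.2 + scalev (2 * (dot O X.2 - X.1) / (1 - dot O O)) O).

Arguments boost : simpl never.

(** A future time-like vector on the ray through the hyperboloid point above
x: the point itself is obtained on dividing by 1 - dot x x.  The equation of
[geod a b] says that this vector is Lorentz orthogonal to (a, b). *)
Definition hyp_ray (R : realType) (x : R * R) : R * (R * R) :=
  (1 + dot x x, scalev 2 x).

(** Central projection of the boosted hyperboloid point to the affine plane of
time coordinate 1. *)
Definition klein (R : realType) (O x : R * R) : R * R :=
  scalev (boost O (hyp_ray x)).1^-1 (boost O (hyp_ray x)).2.

(** Stereographic projection of the hyperboloid point of the ray through
[boost (- O) (1, k)], whose Lorentz square is dot k k - 1. *)
Definition klein_inv (R : realType) (O k : R * R) : R * R :=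
  scalev ((boost (- O) (1, k)).1 + Num.sqrt (1 - dot k k))^-1 (boost (- O) (1, k)).2.

Lemma hplane_neq0 (R : realType) (O : R * R) : hplane O -> 1 - dot O O != 0.
Proof. by move=> h; rewrite lt0r_neq0 // subr_gt0. Qed.

Lemma boost_mdot (R : realType) (O : R * R) X Y : hplane O ->
  mdot (boost O X) (boost O Y) = mdot X Y.
Proof.
move/hplane_neq0; case: O X Y => [p q] [x0 [x1 x2]] [y0 [y1 y2]].
rewrite /mdot /boost /scalev /dot /= => h; field; exact: h.
Qed.

Lemma boostK (R : realType) (O : R * R) X : hplane O ->
  boost O (boost (- O) X) = X.
Proof.
move/hplane_neq0; case: O X => [p q] [x0 [x1 x2]].
rewrite /boost /scalev /dot /= => h.
by congr (_, (_, _)) => /=; field; rewrite ?mulrNN h.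
Qed.

Lemma hplaneN (R : realType) (O : R * R) : hplane O -> hplane (- O).
Proof. by rewrite /hplane /= /dot /= !mulrNN. Qed.

Lemma boostNK (R : realType) (O : R * R) X : hplane O ->
  boost (- O) (boost O X) = X.
Proof. by move=> h; have := boostK X (hplaneN h); rewrite opprK. Qed.

Lemma boost_scalev (R : realType) (O : R * R) (a b : R) (k : R * R) :
  boost O (a * b, scalev a k) = (a * (boost O (b, k)).1, scalev a (boost O (b, k)).2).
Proof.
rewrite /boost /scalev /dot /=; congr (_, (_, _)) => /=; ring.
Qed.

Lemma hyp_ray_gt0 (R : realType) (O x : R * R) : hplane O -> hplane x ->
  0 < (boost O (hyp_ray x)).1.
Proof.
move=> hO hx.
have -> : (boost O (hyp_ray x)).1 = ((1 - dot O O) * (1 - dot x x) +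
    2 * dot (O - x) (O - x)) / (1 - dot O O).
  by rewrite /boost /hyp_ray /scalev /dot /=; congr (_ / _); ring.
rewrite divr_gt0 ?subr_gt0 //.
rewrite ltr_wpDr ?mulr_gt0 ?subr_gt0 //.
by rewrite mulr_ge0 ?ler0n ?dot_ge0.
Qed.

Lemma boost_hyp_ray (R : realType) (O x : R * R) : hplane O -> hplane x ->
  boost O (hyp_ray x) = ((boost O (hyp_ray x)).1 * 1,
    scalev (boost O (hyp_ray x)).1 (klein O x)).
Proof.
move=> hO hx; have h := lt0r_neq0 (hyp_ray_gt0 hO hx).
rewrite mulr1 /klein; set Y := boost _ _ in h *.
case: Y h => [a [b c]] /= h; rewrite /scalev /= !mulrA divff // !mul1r.
by [].
Qed.

(** The boost of the ray vector of x is a multiple of (1, klein O x), and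
boosts preserve the Lorentz form. *)
Lemma klein_norm (R : realType) (O x : R * R) : hplane O -> hplane x ->
  1 - dot (klein O x) (klein O x) = ((1 - dot x x) / (boost O (hyp_ray x)).1) ^+ 2.
Proof.
move=> hO hx; have h := lt0r_neq0 (hyp_ray_gt0 hO hx).
have := boost_mdot (hyp_ray x) (hyp_ray x) hO; rewrite boost_hyp_ray //.
set A := (boost _ _).1 in h *; move: (klein O x) => k.
have -> : mdot (hyp_ray x) (hyp_ray x) = - (1 - dot x x) ^+ 2.
  by rewrite /mdot /hyp_ray /scalev /dot /=; ring.
have -> : mdot (A * 1, scalev A k) (A * 1, scalev A k) = - A ^+ 2 * (1 - dot k k).
  by rewrite /mdot /scalev /dot /=; ring.
move/eqP; rewrite mulNr eqr_opp => /eqP e.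
by rewrite expr_div_n -e /= mulr1; field.
Qed.

Lemma klein_hplane (R : realType) (O x : R * R) : hplane O -> hplane x ->
  hplane (klein O x).
Proof.
move=> hO hx; rewrite /hplane /= -subr_gt0 klein_norm // exprn_gt0 //.
by rewrite divr_gt0 ?hyp_ray_gt0 // subr_gt0.
Qed.

Lemma boost_gt0 (R : realType) (O k : R * R) : hplane O -> hplane k ->
  0 < (boost O (1, k)).1.
Proof.
move=> hO hk; rewrite /boost /= divr_gt0 ?subr_gt0 // mulr1.
have : 0 <= dot (O - k) (O - k) by exact: dot_ge0.
have -> : dot (O - k) (O - k) = dot O O + dot k k - 2 * dot O k.
  by rewrite /dot /=; ring.
move: hO hk; rewrite /hplane /=; lra.
Qed.

Lemma klein_invP (R : realType) (O k : R * R) : hplane O -> hplane k ->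
  hplane (klein_inv O k) /\ klein O (klein_inv O k) = k.
Proof.
move=> hO hk; have Y0 := boost_gt0 (hplaneN hO) hk.
have YY : mdot (boost (- O) (1, k)) (boost (- O) (1, k)) = mdot (1, k) (1, k).
  exact/boost_mdot/hplaneN.
have YK := boostK (1, k) hO.
rewrite /klein_inv; move: YY YK Y0.
case: (boost (- O) (1, k)) => [y0 y]; rewrite {1 2}/mdot /= => YY YK Y0.
have w0 : 0 < 1 - dot k k by rewrite subr_gt0.
set w := Num.sqrt _; have wgt : 0 < w by rewrite sqrtr_gt0.
have ww : w ^+ 2 = 1 - dot k k by rewrite sqr_sqrtr // ltW.
have yy : dot y y = y0 ^+ 2 - w ^+ 2.
  by rewrite ww; move: YY; rewrite mulr1 => YY; rewrite expr2; lra.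
have yw : y0 + w != 0 by rewrite lt0r_neq0 // addr_gt0.
set x := scalev _ y.
have xx : dot x x = (y0 - w) / (y0 + w).
  have -> : dot x x = dot y y / (y0 + w) ^+ 2.
    by rewrite /x /scalev /dot /=; field.
  by rewrite yy; field.
have hx : hplane x.
  by rewrite /hplane /= xx ltr_pdivrMr ?addr_gt0 // mul1r; lra.
split=> //.
rewrite /klein (_ : hyp_ray x = (2 / (y0 + w) * y0, scalev (2 / (y0 + w)) y)); last first.
  rewrite /hyp_ray xx /x /scalev /=; congr (_, (_, _)); by field.
rewrite boost_scalev YK /= mulr1 [RHS]surjective_pairing /scalev /=; by congr pair; field.
Qed.

Lemma klein_inj (R : realType) (O x y : R * R) : hplane O -> hplane x ->
  hplane y -> klein O x = klein O y -> x = y.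
Proof.
move=> hO hx hy e.
have A0 := hyp_ray_gt0 hO hx; have B0 := hyp_ray_gt0 hO hy.
have := boost_hyp_ray hO hx; have := boost_hyp_ray hO hy.
move: (klein_norm hO hx) (klein_norm hO hy); rewrite e => ->.
move: A0 B0; set A := (boost _ (hyp_ray x)).1; set B := (boost _ (hyp_ray y)).1.
move=> A0 B0 eAB eB eA.
have x0 : 0 < 1 - dot x x by rewrite subr_gt0.
have y0 : 0 < 1 - dot y y by rewrite subr_gt0.
have {}eAB : (1 - dot x x) / A = (1 - dot y y) / B.
  by apply/eqP; rewrite -(@eqrXn2 _ 2) ?eAB // divr_ge0 ?ltW.
have lx : hyp_ray x = (A * (boost (- O) (1, klein O y)).1,
   scalev A (boost (- O) (1, klein O y)).2).
  by rewrite -boost_scalev -eA boostNK.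
have ly : hyp_ray y = (B * (boost (- O) (1, klein O y)).1,
   scalev B (boost (- O) (1, klein O y)).2).
  by rewrite -boost_scalev -eB boostNK.
move: lx ly eAB; case: (boost (- O) _) => [c [c1 c2]].
rewrite /hyp_ray /scalev /=.
move=> [a0 a1 a2] [b0 b1 b2].
have An : A != 0 by exact: lt0r_neq0.
have Bn : B != 0 by exact: lt0r_neq0.
move/eqP; rewrite eqr_div // => /eqP eAB.
have dx : dot x x = A * c - 1 by rewrite -a0; ring.
have dy : dot y y = B * c - 1 by rewrite -b0; ring.
have AB : A = B by move: eAB; rewrite dx dy; lra.
rewrite (surjective_pairing x) (surjective_pairing y).
have two : (2 : R) != 0 by rewrite pnatr_eq0.
by congr pair; apply: (mulfI two); rewrite ?a1 ?a2 ?b1 ?b2 AB.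
Qed.

Lemma klein_origin (R : realType) (O : R * R) : hplane O -> klein O O = (0, 0).
Proof.
move=> hO; have := hplane_neq0 hO; rewrite /klein /boost /hyp_ray /= => h.
by rewrite /scalev /=; congr pair; rewrite /dot /=; rewrite /dot in h;
  apply/eqP; rewrite mulf_eq0; apply/orP; right; apply/eqP; field.
Qed.

(** The left-hand side is minus the Lorentz product of the hyperboloid points
of x and y, hence does not change under the boost. *)
Lemma cosh_hdist (R : realType) (O x y : R * R) : hplane O -> hplane x -> hplane y ->
  1 + 2 * dot (x - y) (x - y) / ((1 - dot x x) * (1 - dot y y)) =
  (1 - dot (klein O x) (klein O y)) /
   (Num.sqrt (1 - dot (klein O x) (klein O x)) *
    Num.sqrt (1 - dot (klein O y) (klein O y))).
Proof.
move=> hO hx hy.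
have A0 := hyp_ray_gt0 hO hx; have B0 := hyp_ray_gt0 hO hy.
have x0 : 0 < 1 - dot x x by rewrite subr_gt0.
have y0 : 0 < 1 - dot y y by rewrite subr_gt0.
have xA := divr_ge0 (ltW x0) (ltW A0); have yB := divr_ge0 (ltW y0) (ltW B0).
rewrite !klein_norm // !sqrtr_sqr (ger0_norm xA) (ger0_norm yB) {xA yB}.
have := boost_mdot (hyp_ray x) (hyp_ray y) hO.
rewrite boost_hyp_ray // (boost_hyp_ray hO hy).
move: A0 B0; set A := (boost _ (hyp_ray x)).1; set B := (boost _ (hyp_ray y)).1.
move=> A0 B0.
have -> : mdot (A * 1, scalev A (klein O x)) (B * 1, scalev B (klein O y)) =
  - (A * B * (1 - dot (klein O x) (klein O y))).
  by rewrite /mdot /scalev /dot /=; ring.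
set k := (1 - dot (klein O x) _).
have -> : mdot (hyp_ray x) (hyp_ray y) = - ((1 - dot x x) * (1 - dot y y) +
   2 * dot (x - y) (x - y)).
  by rewrite /mdot /hyp_ray /scalev /dot /=; ring.
move/oppr_inj => e.
have -> : 2 * dot (x - y) (x - y) = A * B * k - (1 - dot x x) * (1 - dot y y).
  by rewrite e; ring.
rewrite /= !mulr1; field; rewrite !lt0r_neq0 //.
Qed.

(** * Geodesics are straight in Klein coordinates *)

(** Invariance of Lorentz orthogonality under the boost: a geodesic is cut out
by a linear equation in Klein coordinates. *)
Lemma geod_klein (R : realType) (O : R * R) (a : R) (b : R * R) : hplane O ->
  geod a b = [set z | hplane z /\
    dot (boost O (a, b)).2 (klein O z) = (boost O (a, b)).1].
Proof.
move=> hO; apply/seteqP; split=> z /= [hz h]; split=> //.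
all: have A0 := hyp_ray_gt0 hO hz; have := boost_mdot (a, b) (hyp_ray z) hO.
all: rewrite [boost O (hyp_ray z)]boost_hyp_ray //.
all: move: A0; set A := (boost _ _).1; set N := boost _ _ => A0.
all: have -> : mdot N (A * 1, scalev A (klein O z)) = A * (dot N.2 (klein O z) - N.1)
  by rewrite /mdot /scalev /dot /=; ring.
all: have -> : mdot (a, b) (hyp_ray z) = 2 * dot b z - a * (1 + dot z z)
  by rewrite /mdot /hyp_ray /scalev /dot /=; ring.
  rewrite h subrr => /eqP; rewrite mulf_eq0 subr_eq0 gt_eqF //= => /eqP //.
by rewrite h subrr mulr0 => /esym /eqP; rewrite subr_eq0 => /eqP ->.
Qed.

(** Conversely, a line given by a space-like covector is a geodesic. *)
Lemma chord_geod (R : realType) (O : R * R) (c : R) (n : R * R) : hplane O ->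
  c ^+ 2 < dot n n -> exists a b, [/\ a ^+ 2 < dot b b, boost O (a, b) = (c, n) &
    [set z | hplane z /\ dot n (klein O z) = c] = geod a b].
Proof.
move=> hO hc; have E := boostK (c, n) hO.
have := boost_mdot (c, n) (c, n) (hplaneN hO); move: E.
case: (boost (- O) _) => a b E; rewrite /mdot /= => h.
exists a, b; split=> //; last by rewrite (geod_klein _ _ hO) E.
by rewrite expr2 -subr_gt0 h -expr2 subr_gt0.
Qed.

(** At a common point of two geodesics, the Euclidean product of their normal
vectors in the conformal model is the Lorentz product of their covectors. *)
Lemma perp_boost (R : realType) (O : R * R) (a a' : R) (b b' z : R * R) :
  hplane O -> geod a b z -> geod a' b' z ->
  dot (b - (a * z.1, a * z.2)) (b' - (a' * z.1, a' * z.2)) =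
  mdot (boost O (a, b)) (boost O (a', b')).
Proof.
move=> hO [_ h] [_ h']; rewrite boost_mdot //.
have two : (2 : R) != 0 by rewrite pnatr_eq0.
apply: (mulfI two).
have -> : 2 * dot (b - (a * z.1, a * z.2)) (b' - (a' * z.1, a' * z.2)) =
  2 * dot b b' - a' * (2 * dot b z) - a * (2 * dot b' z) + 2 * (a * a' * dot z z).
  by rewrite /dot /=; ring.
by rewrite -h -h' /mdot /=; ring.
Qed.

(** * Hyperbolic distance along a geodesic *)

(** Abscissa by hyperbolic arc length, measured from the midpoint of a chord
of half-length W. *)
Definition arc_pos (R : realType) (W s : R) : R := (ln (W + s) - ln (W - s)) / 2.

Lemma ltr_arc_pos (R : realType) (W s t : R) : - W < s -> s < t -> t < W ->
  arc_pos W s < arc_pos W t.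
Proof.
move=> h1 h2 h3; rewrite /arc_pos ltr_pM2r ?invr_gt0 ?ltr0n // ltrD //.
  by rewrite ltr_ln ?posrE; lra.
by rewrite ltrN2 ltr_ln ?posrE; lra.
Qed.

Lemma ler_arc_pos (R : realType) (W s t : R) : - W < s < W -> - W < t < W ->
  (arc_pos W s <= arc_pos W t) = (s <= t).
Proof.
move=> /andP[s1 s2] /andP[t1 t2]; case: (ltgtP s t) => [h|h|->]; last exact: lexx.
  by apply/ltW/ltr_arc_pos.
by apply/negbTE; rewrite -ltNge; apply/ltr_arc_pos.
Qed.

Lemma arc_pos_inj (R : realType) (W s t : R) : - W < s < W -> - W < t < W ->
  arc_pos W s = arc_pos W t -> s = t.
Proof.
by move=> hs ht /eqP; rewrite eq_le !ler_arc_pos // => h; apply/eqP; rewrite eq_le.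
Qed.

Lemma arc_posN (R : realType) (W s : R) : arc_pos W (- s) = - arc_pos W s.
Proof. by rewrite /arc_pos opprK; lra. Qed.

Lemma arc_pos0 (R : realType) (W : R) : arc_pos W 0 = 0.
Proof. by rewrite /arc_pos addr0 subr0 subrr mul0r. Qed.

(** The hyperbolic cosine of ln e is the mean of e and its inverse. *)
Lemma acosh_mean (R : realType) (e : R) : 1 <= e -> acosh ((e + e^-1) / 2) = ln e.
Proof.
move=> e1; have e0 : 0 < e by lra.
rewrite /acosh (_ : _ - 1 = ((e - e^-1) / 2) ^+ 2); last first.
  by field; rewrite lt0r_neq0.
rewrite sqrtr_sqr ger0_norm; first by congr ln; field; rewrite lt0r_neq0.
rewrite divr_ge0 ?ler0n // subr_ge0 (le_trans _ e1) // invf_le1 //.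
Qed.

Lemma sqrt_lnM (R : realType) (x y : R) : 0 < x -> 0 < y ->
  Num.sqrt (x * y) = expR ((ln x + ln y) / 2).
Proof.
move=> x0 y0; rewrite -[RHS]ger0_norm ?expR_ge0 // -sqrtr_sqr; congr Num.sqrt.
rewrite -expRM_natr mulfVK ?pnatr_eq0 // expRD !lnK //.
Qed.

Lemma acosh_chord (R : realType) (W s t : R) : - W < s < W -> - W < t < W ->
  acosh ((W ^+ 2 - s * t) /
    (Num.sqrt (W ^+ 2 - s ^+ 2) * Num.sqrt (W ^+ 2 - t ^+ 2))) =
  `|arc_pos W s - arc_pos W t|.
Proof.
wlog st : s t / t <= s.
  move=> H hs ht; have /orP[h|h] := le_total t s; first exact: H.
  by rewrite distrC -H // [X in acosh (_ / X)]mulrC [s * t]mulrC.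
move=> hs ht; have := ler_arc_pos ht hs; rewrite st => d0.
have /andP[s1 s2] := hs; have /andP[t1 t2] := ht.
have a0 : 0 < W + s by lra.
have b0 : 0 < W - s by lra.
have c0 : 0 < W + t by lra.
have d1 : 0 < W - t by lra.
rewrite ger0_norm ?subr_ge0 //.
rewrite -[RHS]expRK -acosh_mean; last by rewrite -expR0 ler_expR subr_ge0.
congr acosh; rewrite -expRN.
have -> : W ^+ 2 - s ^+ 2 = (W + s) * (W - s) by ring.
have -> : W ^+ 2 - t ^+ 2 = (W + t) * (W - t) by ring.
rewrite !sqrt_lnM //.
(* With e = sqrt ((W + s) (W - t) / ((W - s) (W + t))), the argument of acosh
is the mean of e and its inverse. *)
have -> : W ^+ 2 - s * t = ((W + s) * (W - t) + (W - s) * (W + t)) / 2 by field.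
have -> : (W + s) * (W - t) = expR (ln (W + s) + ln (W - t)).
  by rewrite expRD !lnK.
have -> : (W - s) * (W + t) = expR (ln (W - s) + ln (W + t)).
  by rewrite expRD !lnK.
rewrite -expRD mulrAC; congr (_ / _); rewrite -expRN mulrDl -!expRD /arc_pos.
congr (expR _ + expR _); lra.
Qed.

(** For a unit vector v and c ^+ 2 < 1: the geodesic which in Klein
coordinates is the chord directed by v at signed distance c from the centre;
dot v (klein O z) is the abscissa of z on it, and the half-length of the chord
is sqrt (1 - c ^+ 2). *)
Definition chord (R : realType) (O : R * R) (c : R) (v : R * R) : set (R * R) :=
  [set z | hplane z /\ dot (turn v) (klein O z) = c].

Lemma chord_coord (R : realType) (O : R * R) c v z : hplane O -> dot v v = 1 ->
  chord O c v z -> - Num.sqrt (1 - c ^+ 2) < dot v (klein O z) < Num.sqrt (1 - c ^+ 2).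
Proof.
move=> hO hv [hz hc]; rewrite -ltr_norml -sqrtr_sqr.
have := klein_hplane hO hz; rewrite /hplane /= (dot_turn_basis _ _ hv) hc -!expr2 => h.
rewrite ltr_sqrt; last by have := sqr_ge0 (dot v (klein O z)); lra.
lra.
Qed.

Lemma chord_inj (R : realType) (O : R * R) c v x y : hplane O -> dot v v = 1 ->
  chord O c v x -> chord O c v y -> dot v (klein O x) = dot v (klein O y) -> x = y.
Proof.
move=> hO hv [hx cx] [hy cy] e; apply: (@klein_inj _ O) => //.
by rewrite (turn_basis (klein O x) hv) (turn_basis (klein O y) hv) cx cy e.
Qed.

(** For points with abscissae s and t on a chord of half-length W, the formula
for the hyperbolic cosine of the distance becomes (W ^+ 2 - s * t) / (sqrt (W
^+ 2 - s ^+ 2) * sqrt (W ^+ 2 - t ^+ 2)). *)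
Lemma hdist_chord (R : realType) (O : R * R) c v x y : hplane O -> dot v v = 1 ->
  chord O c v x -> chord O c v y ->
  hdist x y = `|arc_pos (Num.sqrt (1 - c ^+ 2)) (dot v (klein O x)) -
                arc_pos (Num.sqrt (1 - c ^+ 2)) (dot v (klein O y))|.
Proof.
move=> hO hv hx hy.
have sx := chord_coord hO hv hx; have sy := chord_coord hO hv hy.
rewrite -acosh_chord //.
have W0 : 0 < Num.sqrt (1 - c ^+ 2) by case/andP: sx; lra.
have W2 : Num.sqrt (1 - c ^+ 2) ^+ 2 = 1 - c ^+ 2.
  by rewrite sqr_sqrtr // ltW // -sqrtr_gt0.
rewrite W2; case: hx hy => [hx cx] [hy cy].
rewrite /hdist (cosh_hdist hO hx hy)
  (dot_turn_basis (klein O x) (klein O y) hv)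
  (dot_turn_basis (klein O x) (klein O x) hv)
  (dot_turn_basis (klein O y) (klein O y) hv) cx cy -!expr2.
by rewrite !opprD !addrA.
Qed.

Lemma hsegment_chord (R : realType) (O : R * R) c v p q x : hplane O -> dot v v = 1 ->
  chord O c v p -> chord O c v q -> chord O c v x ->
  dot v (klein O p) <= dot v (klein O q) ->
  hsegment p q x <-> dot v (klein O p) <= dot v (klein O x) <= dot v (klein O q).
Proof.
move=> hO hv hp hq hx pq; have sp := chord_coord hO hv hp.
have sq := chord_coord hO hv hq; have sx := chord_coord hO hv hx.
rewrite /hsegment /= (hdist_chord hO hv hp hx) (hdist_chord hO hv hx hq)
  (hdist_chord hO hv hp hq).
rewrite -!(ler_arc_pos sp) // -(ler_arc_pos sx) //; move: pq.
rewrite -(ler_arc_pos sp) //.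
set a := arc_pos _ _; set b := arc_pos _ (dot v (klein O q)).
set s := arc_pos _ (dot v (klein O x)).
have dE (t u : R) : t <= u -> `|t - u| = u - t.
  by move=> tu; rewrite distrC ger0_norm // subr_ge0.
move=> ab; rewrite (dE a b) //; split.
  move=> [_ h]; apply/andP; split.
    by have := ler_norm (s - b); have := ler_norm (a - s);
       have := ler_norm (- (s - b)); have := ler_norm (-(a - s)); rewrite !normrN; lra.
    by have := ler_norm (s - b); have := ler_norm (a - s);
       have := ler_norm (- (s - b)); have := ler_norm (-(a - s)); rewrite !normrN; lra.
move=> /andP[h1 h2]; split; first by case: hx.
by rewrite (dE a s) // (dE s b) //; lra.
Qed.

Lemma hsegmentC (R : realType) (p q : R * R) : hsegment p q = hsegment q p.
Proof.
have hC x y : @hdist R x y = hdist y x.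
  rewrite /hdist [X in _ / X]mulrC; congr (acosh (1 + 2 * _ / _)).
  by rewrite /dot /=; ring.
by apply/seteqP; split=> x [hx h]; split=> //; move: h;
  rewrite (hC p q) (hC p x) (hC q x) addrC // (hC x q) (hC x p).
Qed.

Lemma hsegment_ends (R : realType) (p q : R * R) : hplane p -> hplane q ->
  hsegment p q p /\ hsegment p q q.
Proof.
have h0 x : @hdist R x x = 0.
  by rewrite /hdist subrr /dot /= mulr0 addr0 mulr0 mul0r addr0 /acosh expr1n subrr
    sqrtr0 addr0 ln1.
by move=> hp hq; rewrite /hsegment /= !h0 addr0 add0r.
Qed.

(** Equality in the triangle inequality on a geodesic means betweenness of
abscissae, because [arc_pos] is increasing and distances are its differences.
*)
Lemma hsegment_on_chord (R : realType) (O : R * R) c v (S : set (R * R)) p q :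
  hplane O -> dot v v = 1 -> S `<=` chord O c v -> hplane p -> hplane q ->
  S = hsegment p q ->
  exists p' q', [/\ S p', S q', dot v (klein O p') <= dot v (klein O q'),
   hdist p q = arc_pos (Num.sqrt (1 - c ^+ 2)) (dot v (klein O q')) -
                arc_pos (Num.sqrt (1 - c ^+ 2)) (dot v (klein O p')) &
   forall x, chord O c v x ->
    (S x <-> dot v (klein O p') <= dot v (klein O x) <= dot v (klein O q'))].
Proof.
move=> hO hv SG hp hq eS; have [pp qq] := hsegment_ends hp hq.
rewrite -!eS in pp qq; have gp := SG _ pp; have gq := SG _ qq.
have sp := chord_coord hO hv gp; have sq := chord_coord hO hv gq.
have [h|h] := leP (dot v (klein O p)) (dot v (klein O q)).
  exists p, q; split=> //; last first.
    by move=> x hx; rewrite eS; exact: (hsegment_chord hO hv gp gq hx h).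
  by rewrite (hdist_chord hO hv gp gq) distrC ger0_norm // subr_ge0 ler_arc_pos.
move/ltW in h; exists q, p; split=> //.
  by rewrite (hdist_chord hO hv gp gq) ger0_norm // subr_ge0 ler_arc_pos.
by move=> x hx; rewrite eS hsegmentC; exact: (hsegment_chord hO hv gq gp hx h).
Qed.

Lemma klein_inv_chord (R : realType) (O : R * R) v s : hplane O -> dot v v = 1 ->
  - 1 < s < 1 -> [/\ hplane (klein_inv O (scalev s v)),
    klein O (klein_inv O (scalev s v)) = scalev s v & chord O 0 v (klein_inv O (scalev s v))].
Proof.
move=> hO hv hs; have hk : hplane (scalev s v).
  by rewrite /hplane /= dot_scalev hv mulr1; case/andP: hs => s1 s2; nra.
have [h1 h2] := klein_invP hO hk; split=> //; split=> //.
by rewrite h2 /dot /turn /scalev /=; ring.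
Qed.

(** * Continuity of Klein coordinates *)

Lemma dot_cvg (R : realType) (d x : R * R) : (fun z => dot d z) @ x --> dot d x.
Proof.
have c1 : (fun z : R * R => z.1) @ x --> x.1 by exact: cvg_fst.
have c2 : (fun z : R * R => z.2) @ x --> x.2 by exact: cvg_snd.
exact: (cvgD (cvgM (cvg_cst d.1) c1) (cvgM (cvg_cst d.2) c2)).
Qed.

Lemma dot_sqr_cvg (R : realType) (x : R * R) : (fun z => dot z z) @ x --> dot x x.
Proof.
have c1 : (fun z : R * R => z.1) @ x --> x.1 by exact: cvg_fst.
have c2 : (fun z : R * R => z.2) @ x --> x.2 by exact: cvg_snd.
exact: (cvgD (cvgM c1 c1) (cvgM c2 c2)).
Qed.

Lemma dot_klein_cvg (R : realType) (O d x : R * R) : hplane O -> hplane x ->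
  (fun z => dot d (klein O z)) @ x --> dot d (klein O x).
Proof.
move=> hO hx; have A0 := lt0r_neq0 (hyp_ray_gt0 hO hx).
pose B z := (1 - dot O O)^-1 * ((1 + dot O O) * (1 + dot z z) - 4 * dot O z).
pose C z := 2 * dot d z +
  dot d O * (2 / (1 - dot O O) * (2 * dot O z - (1 + dot z z))).
have eB z : (boost O (hyp_ray z)).1 = B z.
  by rewrite /boost /hyp_ray /B /= mulrC; congr (_ * _); rewrite /dot /scalev /=; ring.
have eK z : dot d (klein O z) = (B z)^-1 * C z.
  by rewrite -eB /klein /C /boost /hyp_ray /scalev /dot /=; ring.
rewrite (_ : (fun z => _) = (fun z => (B z)^-1 * C z)); last exact/funext.
rewrite eB in A0; rewrite eK.
have cO := @dot_cvg R O x; have cd := @dot_cvg R d x.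
have cq : (fun z => 1 + dot z z) @ x --> 1 + dot x x.
  exact: cvgD (cvg_cst _) (@dot_sqr_cvg R x).
have cB : B @ x --> B x.
  apply: cvgM; first exact: cvg_cst.
  apply: cvgB; first by apply: cvgM => //; exact: cvg_cst.
  by apply: cvgM => //; exact: cvg_cst.
have cC : C @ x --> C x.
  apply: cvgD; first by apply: cvgM => //; exact: cvg_cst.
  apply: cvgM; first exact: cvg_cst.
  apply: cvgM; first exact: cvg_cst.
  by apply: cvgB => //; apply: cvgM => //; exact: cvg_cst.
by apply: cvgM => //; apply: cvgV.
Qed.

Lemma klein_inv_cvg (R : realType) (O k : R * R) : hplane O -> hplane k ->
  klein_inv O @ k --> klein_inv O k.
Proof.
move=> hO hk; pose B l := (1 - dot O O)^-1 * ((1 + dot O O) + 2 * dot O l) +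
  Num.sqrt (1 - dot l l).
pose c l := - (2 / (1 - dot O O)) * (dot O l + 1).
have eB l : (boost (- O) (1, l)).1 + Num.sqrt (1 - dot l l) = B l.
  rewrite /B; congr (_ + _); rewrite /boost /= mulrC.
  by congr (_^-1 * _); rewrite /dot /=; ring.
have eK l : klein_inv O l = ((B l)^-1 * (l.1 - c l * O.1), (B l)^-1 * (l.2 - c l * O.2)).
  rewrite -eB /klein_inv /scalev {2 4}/boost /c /scalev /=; congr (_ * _, _ * _).
    by rewrite /dot /= !mulrNN; ring.
  by rewrite /dot /= !mulrNN; ring.
have -> : klein_inv O = fun l =>
    ((B l)^-1 * (l.1 - c l * O.1), (B l)^-1 * (l.2 - c l * O.2)).
  by apply/funext => l; exact: eK.
have c1 : (fun z : R * R => z.1) @ k --> k.1 by exact: cvg_fst.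
have c2 : (fun z : R * R => z.2) @ k --> k.2 by exact: cvg_snd.
have cO := @dot_cvg R O k.
have B0 : B k != 0.
  rewrite -eB gt_eqF // addr_gt0 ?sqrtr_gt0 ?subr_gt0 //.
  exact: boost_gt0 (hplaneN hO) hk.
have cB : B @ k --> B k.
  apply: cvgD.
    apply: cvgM; first exact: cvg_cst.
    apply: cvgD; first exact: cvg_cst.
    by apply: cvgM => //; exact: cvg_cst.
  have cq : (fun z => 1 - dot z z) @ k --> 1 - dot k k.
    exact: cvgB (cvg_cst _) (@dot_sqr_cvg R k).
  exact: (cvg_comp _ _ cq (@sqrt_continuous R _)).
have cc : c @ k --> c k.
  apply: cvgM; first exact: cvg_cst.
  by apply: cvgD => //; exact: cvg_cst.
have h1 : (fun l => (B l)^-1 * (l.1 - c l * O.1)) @ k --> (B k)^-1 * (k.1 - c k * O.1).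
  apply: cvgM; first exact: cvgV.
  by apply: cvgB => //; apply: cvgM => //; exact: cvg_cst.
have h2 : (fun l => (B l)^-1 * (l.2 - c l * O.2)) @ k --> (B k)^-1 * (k.2 - c k * O.2).
  apply: cvgM; first exact: cvgV.
  by apply: cvgB => //; apply: cvgM => //; exact: cvg_cst.
exact: (cvg_pair h1 h2).
Qed.

Lemma ray_cvg (R : realType) (k d : R * R) :
  (fun e : R => k + scalev e d) @ (0 : R) --> k.
Proof.
have h (a b : R) : (fun e : R => a + e * b) @ (0 : R) --> a.
  rewrite -[X in _ --> X]addr0 -[X in _ --> _ + X](mul0r b).
  by apply: cvgD; [exact: cvg_cst|apply: cvgM; [exact: cvg_id|exact: cvg_cst]].
by case: k => k1 k2; exact: (cvg_pair (h k1 d.1) (h k2 d.2)).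
Qed.

Lemma hplane_nbhs (R : realType) (x : R * R) : hplane x -> nbhs x (@hplane R).
Proof. by move=> hx; exact: (cvgr_lt _ (@dot_sqr_cvg R x) _ hx). Qed.

(** An interior point can be moved slightly inside K in any prescribed Klein
direction. *)
Lemma interior_ray (R : realType) (O : R * R) (K : set (R * R)) (x d : R * R) :
  hplane O -> hplane x -> interior K x ->
  exists e, 0 < e /\ exists y, [/\ K y, hplane y & klein O y = klein O x + scalev e d].
Proof.
move=> hO hx Kx; have hk := klein_hplane hO hx.
have ix : klein_inv O (klein O x) = x.
  by have [h1 h2] := klein_invP hO hk; exact: (klein_inj hO).
have c1 := @ray_cvg R (klein O x) d.
have c2 := cvg_comp _ _ c1 (klein_inv_cvg hO hk).
rewrite ix in c2.
have n1 : \forall e \near (0 : R), hplane (klein O x + scalev e d).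
  exact: c1 (hplane_nbhs hk).
have n2 : \forall e \near (0 : R), K (klein_inv O (klein O x + scalev e d)).
  exact: c2 Kx.
have n3 : \forall e \near (0 : R), hplane (klein O x + scalev e d) /\
    K (klein_inv O (klein O x + scalev e d)) by exact: filterI n1 n2.
have /nbhs_ballP[e /= e0 He] := n3.
exists (e / 2); split; first by rewrite divr_gt0.
have hb : ball (0 : R) e (e / 2).
  by rewrite -ball_normE /ball_ /= sub0r normrN ger0_norm; lra.
have [h1 h2] := He _ hb.
exists (klein_inv O (klein O x + scalev (e / 2) d)); split => //.
  by case: (klein_invP hO h1).
by case: (klein_invP hO h1).
Qed.

Lemma sqr_klein_cvg (R : realType) (O x : R * R) : hplane O -> hplane x ->
  (fun z => dot (klein O z) (klein O z)) @ x --> dot (klein O x) (klein O x).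
Proof.
move=> hO hx.
have e z : dot (klein O z) (klein O z) = dot (1, 0) (klein O z) * dot (1, 0) (klein O z)
    + dot (0, 1) (klein O z) * dot (0, 1) (klein O z).
  by rewrite /dot /= !mul1r !mul0r addr0 add0r.
under eq_fun do rewrite e.
rewrite e; have h d := @dot_klein_cvg R O d x hO hx.
exact: (cvgD (cvgM (h (1, 0)) (h (1, 0))) (cvgM (h (0, 1)) (h (0, 1)))).
Qed.

Lemma klein_ball_interior (R : realType) (O : R * R) (K : set (R * R)) (r : R) x :
  hplane O -> hplane x ->
  (forall z, hplane z -> dot (klein O z) (klein O z) < r -> K z) ->
  dot (klein O x) (klein O x) < r -> interior K x.
Proof.
move=> hO hx hK hr; have hc := @sqr_klein_cvg R O x hO hx.
apply: filterS (filterI (hplane_nbhs hx) (cvgr_lt _ hc _ hr)) => z [h1 h2].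
exact: hK.
Qed.

(** * Sections and projections on geodesics through the origin *)

Lemma chord_geodesic (R : realType) (O : R * R) c v : hplane O -> dot v v = 1 ->
  c ^+ 2 < 1 -> is_geodesic (chord O c v).
Proof.
move=> hO hv hc; have [|a [b [ab _ e]]] := @chord_geod R O c (turn v) hO.
  by rewrite dot_turn hv.
by exists a, b.
Qed.

Lemma diameter_coord (R : realType) (O : R * R) v z : hplane O -> dot v v = 1 ->
  chord O 0 v z -> - 1 < dot v (klein O z) < 1.
Proof. by move=> hO hv /(chord_coord hO hv); rewrite expr0n subr0 sqrtr1. Qed.

(** A diameter has covector (0, n) with n orthogonal to v, so its
perpendiculars are the geodesics with covector (c, n') where n' is a multiple
of v. *)
Lemma normal_geodesicE (R : realType) (O v x : R * R) : hplane O -> dot v v = 1 ->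
  chord O 0 v x -> normal_geodesic (chord O 0 v) x =
    [set y | hplane y /\ dot v (klein O y) = dot v (klein O x)].
Proof.
move=> hO hv xG; apply/seteqP; split=> y /=.
  move=> [H [_ Hx [a [b [a' [b' [ab eG ab' eH [z [Gz Hz perp]]]]]]] Hy]].
  rewrite eG in Gz; rewrite eH in Hx Hy Hz; rewrite (perp_boost hO Gz Hz) in perp.
  have := boost_mdot (a, b) (a, b) hO; have := boost_mdot (a', b') (a', b') hO.
  move: perp eG Hx Hy; rewrite !(geod_klein _ _ hO).
  case: (boost O (a, b)) (boost O (a', b')) => [c n] [c' n'].
  rewrite {1}/mdot /= => perp eG [hx Hx] [hy Hy] N' N; split=> //.
  (* The covector (c, n) is determined by the set of points of the diameter
  only up to a factor; its values at 0 and at v / 2 give c = 0 and n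
  orthogonal to v. *)
have inG k : hplane k -> dot (turn v) k = 0 -> dot n k = c.
    move=> hk k0; have [h1 h2] := klein_invP hO hk.
    have : chord O 0 v (klein_inv O k) by split; rewrite // h2.
    by rewrite eG => -[_]; rewrite h2.
  have c0 : c = 0.
    rewrite -(inG (0, 0)) /hplane /= /dot /= ?mulr0 ?addr0 //; exact: ltr01.
  have nv : dot n v = 0.
    have := inG (scalev (1 / 2) v); rewrite !dot_scalevr c0 dot_turnl mulr0 => h.
    have /eqP : 1 / 2 * dot n v = 0.
      apply: h => //; rewrite /hplane /= dot_scalev hv; lra.
    by rewrite mulf_eq0 => /orP[/eqP ?|/eqP //]; lra.
  have n0 : 0 < dot n n by move: N; rewrite /mdot /= c0; move: ab; nra.
  have n'0 : 0 < dot n' n' - c' * c' by move: N'; rewrite /mdot /=; move: ab'; nra.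
  move: perp n0; rewrite c0 mul0r subr0 (dot_turn_basis n n' hv) (dot_turn_basis n n hv).
  rewrite (dotC v n) nv !mul0r !addr0 => /eqP.
  rewrite mulf_eq0 => /orP[/eqP->|/eqP n't _]; first by rewrite mul0r ltxx.
  move: Hx Hy; rewrite (dot_turn_basis n' (klein O x) hv) (dot_turn_basis n' (klein O y) hv).
  rewrite n't !mul0r !add0r => Hx; rewrite -Hx; apply: mulfI.
  apply/eqP => n'v; move: n'0; rewrite (dot_turn_basis n' n' hv) n't n'v.
  by have := sqr_ge0 c'; rewrite expr2 => h; lra.
move=> [hy e]; have xc := diameter_coord hO hv xG.
have [|a' [b' [ab' eb' eH]]] := @chord_geod R O (dot v (klein O x)) v hO.
  by rewrite hv sqr_lt1.
have [|a [b [ab eb eG]]] := @chord_geod R O 0 (turn v) hO.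
  by rewrite dot_turn hv expr0n ltr01.
have Hx : geod a' b' x by rewrite -eH; case: xG.
have Gx : geod a b x by rewrite -eG.
exists (geod a' b'); split=> //; last by rewrite -eH.
  by exists a', b'.
exists a, b, a', b'; split=> //; exists x; split=> //.
  by rewrite (perp_boost hO Gx Hx) eb eb' /mdot /= dot_turnl mul0r subr0.
Qed.

(** The section of K by the diameter directed by v is the interval [s1, s2] of
abscissae. *)
Definition section_ends (R : realType) (O : R * R) (K : set (R * R)) (v : R * R)
    (s1 s2 : R) : Prop :=
  [/\ -1 < s1, s1 <= s2, s2 < 1 & forall x, chord O 0 v x ->
     (K x <-> s1 <= dot v (klein O x) <= s2)].

(** The interval [t1, t2] is the exact range on K of the orthogonal projection
to the diameter directed by v. *)
Definition shadow_ends (R : realType) (O : R * R) (K : set (R * R)) (v : R * R)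
    (t1 t2 : R) : Prop :=
  [/\ -1 < t1, t2 < 1, (forall x, K x -> t1 <= dot v (klein O x) <= t2),
      (exists2 x, K x & dot v (klein O x) = t1) &
      (exists2 x, K x & dot v (klein O x) = t2)].

Lemma section_endsP (R : realType) (O : R * R) (K : set (R * R)) (v : R * R) l :
  hplane O -> dot v v = 1 -> has_length (K `&` chord O 0 v) l ->
  exists s1 s2, section_ends O K v s1 s2 /\ arc_pos 1 s2 - arc_pos 1 s1 = l.
Proof.
move=> hO hv [p [q [hp hq e <-]]].
have SG : K `&` chord O 0 v `<=` chord O 0 v by move=> x [].
have [p' [q' [[_ Gp] [_ Gq] pq -> h]]] := hsegment_on_chord hO hv SG hp hq e.
have /andP[p1 _] := diameter_coord hO hv Gp.
have /andP[_ q1] := diameter_coord hO hv Gq.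
exists (dot v (klein O p')), (dot v (klein O q')).
rewrite expr0n subr0 sqrtr1; split=> //; split=> // x Gx.
by split=> [Kx|/(h _ Gx) []//]; apply/(h _ Gx).
Qed.

(** The feet of the perpendiculars from the points of K to a diameter have as
abscissae the values of dot v on the Klein coordinates of K. *)
Lemma shadow_endsP (R : realType) (O : R * R) (K : set (R * R)) (v : R * R) l :
  hplane O -> dot v v = 1 -> K `<=` @hplane R ->
  has_length (projection (chord O 0 v) K) l ->
  exists t1 t2, shadow_ends O K v t1 t2 /\ arc_pos 1 t2 - arc_pos 1 t1 = l.
Proof.
move=> hO hv hK [p [q [hp hq e <-]]].
have pE x : projection (chord O 0 v) K x ->
    exists2 y, K y & dot v (klein O y) = dot v (klein O x).
  by move=> [Gx [y [Ky]]]; rewrite normal_geodesicE // => -[_ ?]; exists y.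
have SG : projection (chord O 0 v) K `<=` chord O 0 v by move=> x [].
have [p' [q' [Pp Pq pq -> h]]] := hsegment_on_chord hO hv SG hp hq e.
have [Gp _] := Pp; have [Gq _] := Pq.
have /andP[p1 _] := diameter_coord hO hv Gp.
have /andP[_ q1] := diameter_coord hO hv Gq.
exists (dot v (klein O p')), (dot v (klein O q')).
rewrite expr0n subr0 sqrtr1; split=> //; split=> //; [|exact: pE|exact: pE].
move=> x Kx; have hx := hK _ Kx.
have hs : -1 < dot v (klein O x) < 1.
  have := klein_hplane hO hx.
  rewrite /hplane /= (dot_turn_basis (klein O x) (klein O x) hv).
  have := sqr_ge0 (dot (turn v) (klein O x)); rewrite -!expr2 => h1 h2.
  by rewrite -ltr_norml -sqrtr_sqr -[ltRHS]sqrtr1 ltr_sqrt ?ltr01 //; lra.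
have [h1 h2 h3] := klein_inv_chord hO hv hs.
have e1 : dot v (klein O (klein_inv O (scalev (dot v (klein O x)) v))) =
    dot v (klein O x) by rewrite h2 dot_scalevr hv mulr1.
rewrite -e1; apply/h => //; split => //; exists x; split=> //.
by rewrite normal_geodesicE //; split; rewrite // e1.
Qed.

Lemma hdist_origin (R : realType) (O x : R * R) : hplane O -> hplane x ->
  hdist O x = arc_pos 1 (Num.sqrt (dot (klein O x) (klein O x))).
Proof.
move=> hO hx; have [v hv] := polar_decomposition (klein O x); set r := Num.sqrt _ => er.
have GO : chord O 0 v O by split; rewrite // klein_origin // /dot /= !mulr0 addr0.
have Gx : chord O 0 v x by split; rewrite // er dot_scalevr dot_turnl mulr0.
have r0 : 0 <= r by exact: sqrtr_ge0.
have kx : dot v (klein O x) = r by rewrite er dot_scalevr hv mulr1.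
rewrite (hdist_chord hO hv GO Gx) kx klein_origin // /dot /= !mulr0 addr0.
rewrite expr0n subr0 sqrtr1 arc_pos0 sub0r normrN ger0_norm //.
have := diameter_coord hO hv Gx; rewrite kx -[leLHS](arc_pos0 1) => hr.
by rewrite ler_arc_pos // oppr_lt0 ltr01.
Qed.

(** * The supporting geodesic at the nearest boundary point *)

Lemma interior_chord (R : realType) (O : R * R) (K : set (R * R)) c w x a :
  hplane O -> dot w w = 1 -> chord O c w x -> interior K x ->
  exists e y, [/\ 0 < e, K y, chord O c w y & dot w (klein O y) = dot w (klein O x) + e * a].
Proof.
move=> hO hw [hx xc] Kx.
have [e [e0 [y [Ky hy ey]]]] := interior_ray (scalev a w) hO hx Kx.
exists e, y; split=> //; last by rewrite ey dotDr (dot_scalevr e) (dot_scalevr a) hw mulr1.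
by split=> //; rewrite ey dotDr (dot_scalevr e) (dot_scalevr a) dot_turnl !mulr0 addr0.
Qed.

(** The equation of a geodesic defines a closed subset of the whole plane. *)
Lemma compact_chord (R : realType) (O : R * R) (K : set (R * R)) c v : hplane O ->
  dot v v = 1 -> c ^+ 2 < 1 -> K `<=` @hplane R -> compact K ->
  compact (K `&` chord O c v).
Proof.
move=> hO hv hc hK cK; have [|a [b [_ _ e]]] := @chord_geod R O c (turn v) hO.
  by rewrite dot_turn hv.
pose f (z : R * R) := a * (1 + dot z z) - 2 * dot b z.
have -> : K `&` chord O c v = K `&` f @^-1` [set 0].
  have -> : chord O c v = geod a b by exact: e.
  rewrite /geod /f; apply/seteqP; split=> z /= [Kz]; first by move=> [_ ->]; rewrite subrr.
  by move/eqP; rewrite subr_eq0 => /eqP; split; first exact: Kz; split => //; exact: hK.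
apply: compact_closedI => //; apply: closed_comp; last exact: closed_eq.
move=> z _; apply: cvgB; apply: cvgM; try exact: cvg_cst; last exact: dot_cvg.
by apply: cvgD; [exact: cvg_cst|exact: dot_sqr_cvg].
Qed.

Lemma klein_within_continuous (R : realType) (O w : R * R) (A : set (R * R)) :
  hplane O -> A `<=` @hplane R ->
  {within A, continuous (fun z => dot w (klein O z))}.
Proof.
move=> hO hA; apply: continuous_in_subspaceT => x; rewrite inE => Ax.
exact: dot_klein_cvg hO (hA _ Ax).
Qed.

(** The tangent at a boundary point p to an inscribed ball supports a convex
K.  If y in K lay beyond the tangent, the chord through p and y would enter
the ball behind p, so K would have on it two extreme points b1 and b2 with p
strictly between them, all three on the boundary; and the boundary part of
that chord cannot be a segment, since between b1 and b2 lies an interior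
point. *)
Lemma nearest_support (R : realType) (O : R * R) (K : set (R * R)) (m : R) u p :
  hplane O -> K `<=` @hplane R -> compact K -> hconvex K -> dot u u = 1 -> 0 < m ->
  K p -> ~ interior K p -> klein O p = scalev m u ->
  (forall z, hplane z -> dot (klein O z) (klein O z) < m ^+ 2 -> K z) ->
  forall y, K y -> dot u (klein O y) <= m.
Proof.
move=> hO hK cK vK hu m0 Kp pI ep ball_sub y Ky; rewrite leNgt; apply/negP => ym.
have hp := hK _ Kp; have hy := hK _ Ky.
have [w hw] := polar_decomposition (klein O y - klein O p); set r := Num.sqrt _ => er.
have r0 : 0 <= r by exact: sqrtr_ge0.
have ey : klein O y = klein O p + scalev r w by rewrite -er addrC subrK.
have rw : r * dot u w = dot u (klein O y) - m.
  by rewrite ey dotDr (dot_scalevr r) ep (dot_scalevr m) hu; ring.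
pose c := dot (turn w) (klein O p).
have Gp : chord O c w p by [].
have Gy : chord O c w y by split=> //; rewrite ey dotDr (dot_scalevr r) dot_turnl mulr0 addr0.
have sp0 : 0 < dot w (klein O p).
  rewrite ep (dot_scalevr m) mulr_gt0 // dotC; move: r0; rewrite le_eqVlt => /orP[/eqP r0|r0].
    by move: rw; rewrite -r0 mul0r; lra.
  by rewrite -(pmulr_rgt0 _ r0) rw subr_gt0.
have sy : dot w (klein O p) <= dot w (klein O y) by rewrite ey dotDr (dot_scalevr r) hw mulr1 lerDl.
have syp : dot w (klein O y) != dot w (klein O p).
  apply/eqP => e; have yp : y = p by exact: (chord_inj hO hw Gy Gp e).
  by move: ym; rewrite yp ep (dot_scalevr m) hu mulr1 ltxx.
have cm : c ^+ 2 < m ^+ 2.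
  have : dot (klein O p) (klein O p) = m ^+ 2 by rewrite ep dot_scalev hu mulr1.
  rewrite (dot_turn_basis (klein O p) (klein O p) hw) -/c => <-.
  by rewrite expr2 ltrDl mulr_gt0.
have c1 : c ^+ 2 < 1.
  apply: lt_trans cm _; have := klein_hplane hO hp.
  by rewrite /hplane /= ep dot_scalev hu mulr1.
(* The foot of the perpendicular from the centre to the chord is closer to the
centre than p, hence in the inscribed ball; its abscissa is 0. *)
have [q [hq qI Gq q0]] : exists q, [/\ hplane q, interior K q, chord O c w q &
    dot w (klein O q) = 0].
  have hk : hplane (scalev c (turn w)) by rewrite /hplane /= dot_scalev dot_turn hw mulr1.
  have [h1 h2] := klein_invP hO hk.
  exists (klein_inv O (scalev c (turn w))); split=> //.
  - apply: (klein_ball_interior hO h1 ball_sub).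
    by rewrite h2 dot_scalev dot_turn hw mulr1.
  - by split=> //; rewrite h2 dot_scalevr dot_turn hw mulr1.
  - by rewrite h2 dot_scalevr dotC dot_turnl mulr0.
have Kq : K q by exact: interior_subset qI.
have cKG := compact_chord hO hw c1 hK cK.
have nKG : (K `&` chord O c w) !=set0 by exists p.
have fKG : {within K `&` chord O c w, continuous (fun z => dot w (klein O z))}.
  by apply: klein_within_continuous => // z [/hK].
have [b2 /set_mem[Kb2 Gb2] max2] := compact_EVT_max nKG cKG fKG.
have [b1 /set_mem[Kb1 Gb1] min1] := compact_EVT_min nKG cKG fKG.
(* With a = 1 and a = - 1: the points of largest and least abscissa are on the
boundary. *)
have inB x a : K x -> chord O c w x -> (a != 0) ->
    (forall z, K z -> chord O c w z -> a * dot w (klein O z) <= a * dot w (klein O x)) ->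
    boundary K x.
  move=> Kx Gx a0 hx; split; first exact: subset_closure.
  move=> xI; have [e [z [e0 Kz Gz ez]]] := interior_chord a hO hw Gx xI.
  have := hx z Kz Gz; rewrite ez mulrDr gerDl leNgt => /negP; apply.
  by rewrite mulrCA pmulr_rgt0 // -expr2 exprn_even_gt0.
have Bp : boundary K p by split=> //; exact: subset_closure.
have Bb2 : boundary K b2.
  by apply: (inB _ 1); rewrite ?oner_neq0 // => z Kz Gz; rewrite !mul1r max2 // inE.
have Bb1 : boundary K b1.
  apply: (inB _ (-1)); rewrite ?oppr_eq0 ?oner_neq0 // => z Kz Gz.
  by rewrite !mulN1r lerN2 min1 // inE.
have s1 : dot w (klein O b1) <= 0 by rewrite -q0 min1 // inE.
have s2 : dot w (klein O p) < dot w (klein O b2).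
  by rewrite (lt_le_trans _ (max2 y _)) ?inE // lt_neqAle eq_sym syp.
have [[P [Q hPQ]]|[P [Q [hP hQ e]]]] := vK _ (chord_geodesic hO hw c1).
  have := hPQ b1 (conj Bb1 Gb1); have := hPQ b2 (conj Bb2 Gb2); have := hPQ p (conj Bp Gp).
  have n1 : b1 <> p by move=> e; move: s1; rewrite e; lra.
  have n2 : b2 <> p by move=> e; move: s2; rewrite e ltxx.
  have n3 : b1 <> b2 by move=> e; move: s1 s2; rewrite e; lra.
  by move=> [] /= e1 [] /= e2 [] /= e3; congruence.
have SG : boundary K `&` chord O c w `<=` chord O c w by move=> x [].
have [P' [Q' [_ _ _ _ h]]] := hsegment_on_chord hO hw SG hP hQ e.
have /(h _ Gb1) /andP[h1 _] : (boundary K `&` chord O c w) b1 by [].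
have /(h _ Gb2) /andP[_ h2] : (boundary K `&` chord O c w) b2 by [].
have [[_ nq] _] : (boundary K `&` chord O c w) q; last exact: nq qI.
by apply/(h _ Gq); rewrite q0; apply/andP; split; lra.
Qed.

(** * Rigidity of radial functions *)

(** Dividing the interval from s to t into n steps bounds g s - g t by C * (t
- s) ^+ 2 / n. *)
Lemma quadratic_modulus_cst (R : realType) (g : R -> R) (C : R) :
  (forall s t, g s - g t <= C * (t - s) ^+ 2) -> forall s t, g s <= g t.
Proof.
move=> hg s t; rewrite leNgt; apply/negP => gst.
have step h n : g s - g (s + n%:R * h) <= n%:R * (C * h ^+ 2).
  elim: n => [|n IH]; first by rewrite !mul0r addr0 subrr.
  have := hg (s + n%:R * h) (s + n.+1%:R * h).
  rewrite (_ : s + n.+1%:R * h - _ = h); last by rewrite -natr1; ring.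
  by rewrite -natr1 mulrDl mul1r; lra.
have d0 : 0 < g s - g t by rewrite subr_gt0.
have /= := archi_boundP (divr_ge0 (normr_ge0 (C * (t - s) ^+ 2)) (ltW d0)).
set n := Num.bound _ => hn.
have n0 : (0 : R) < n%:R by apply: le_lt_trans hn; rewrite divr_ge0 ?normr_ge0 // ltW.
have := step ((t - s) / n%:R) n.
rewrite (_ : s + _ = t); last by rewrite mulrCA divff ?gt_eqF // mulr1 addrC subrK.
rewrite (_ : n%:R * _ = C * (t - s) ^+ 2 / n%:R); last by field; rewrite gt_eqF.
rewrite ler_pdivlMr // leNgt => /negP; apply.
by apply: le_lt_trans (ler_norm _) _; rewrite [ltRHS]mulrC -ltr_pdivrMr.
Qed.

(** The hypothesis says that the star body with radial function f is supported
at each boundary point by the perpendicular to the radius.  Along a rational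
parametrization of the unit circle, 1 - dot u w is at most twice the square of
the difference of parameters, so f has a quadratic modulus of continuity along
it and is constant. *)
Lemma support_radial_cst (R : realType) (f : R * R -> R) :
  (forall u, dot u u = 1 -> 0 <= f u <= 1) ->
  (forall u w, dot u u = 1 -> dot w w = 1 -> f w * dot w u <= f u) ->
  forall u w, dot u u = 1 -> dot w w = 1 -> f u = f w.
Proof.
move=> f01 fuw.
have near v u : dot v v = 1 -> dot u u = 1 -> 1 + dot v u != 0 -> f u = f v.
  move=> hv hu huv.
  (* Inverse stereographic projection of the line to the unit circle, with arc
  0 = v and the pole - v omitted. *)
  pose arc t := scalev ((1 - t ^+ 2) / (1 + t ^+ 2)) v + scalev (2 * t / (1 + t ^+ 2)) (turn v).
  have d0 t : 1 + t ^+ 2 != 0 :> R by rewrite gt_eqF // ltr_pwDl ?sqr_ge0.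
  have arcM s t : dot (arc s) (arc t) =
      1 - 2 * (t - s) ^+ 2 / ((1 + s ^+ 2) * (1 + t ^+ 2)).
    have -> : dot (arc s) (arc t) =
        ((1 - s ^+ 2) / (1 + s ^+ 2) * ((1 - t ^+ 2) / (1 + t ^+ 2)) +
         (2 * s / (1 + s ^+ 2)) * (2 * t / (1 + t ^+ 2))) * dot v v.
      by rewrite /arc /turn /dot /scalev /=; ring.
    by rewrite hv mulr1; field; rewrite !d0.
  have arc1 t : dot (arc t) (arc t) = 1.
    by rewrite arcM subrr expr0n mulr0 mul0r subr0.
  have g_cst : forall s t, f (arc s) <= f (arc t).
    apply: (@quadratic_modulus_cst _ (f \o arc) 2) => s t /=.
    have := fuw _ _ (arc1 t) (arc1 s); have /andP[f0 f1] := f01 _ (arc1 s).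
    rewrite arcM.
    have h1 : (1 + s ^+ 2) * (1 + t ^+ 2) >= 1.
      by have := sqr_ge0 s; have := sqr_ge0 t; nra.
    have h2 : 2 * (t - s) ^+ 2 / ((1 + s ^+ 2) * (1 + t ^+ 2)) <= 2 * (t - s) ^+ 2.
      rewrite ler_pdivrMr ?(lt_le_trans _ h1) // ler_peMr //.
      by rewrite mulr_ge0 // sqr_ge0.
    have h3 : 0 <= 2 * (t - s) ^+ 2 / ((1 + s ^+ 2) * (1 + t ^+ 2)).
      by rewrite divr_ge0 ?(le_trans _ h1) // mulr_ge0 // sqr_ge0.
    move: h2 h3; set q := _ / _; set r := 2 * _ ^+ 2; nra.
  have -> : v = arc 0.
    rewrite /arc (_ : (1 - 0 ^+ 2) / (1 + 0 ^+ 2) = 1); last first.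
      by rewrite expr0n /= subr0 addr0 divr1.
    rewrite mulr0 mul0r; case: (v) => a b; rewrite /turn /scalev /=.
    by congr pair => /=; ring.
  have -> : u = arc (dot (turn v) u / (1 + dot v u)).
    set y := dot (turn v) u; set x := dot v u.
    have xy : y ^+ 2 + x ^+ 2 = 1.
      by rewrite -hu (dot_turn_basis u u hv) !expr2.
    have x0 : 1 + x != 0 by [].
    have e : 1 + (y / (1 + x)) ^+ 2 = 2 / (1 + x).
      rewrite expr_div_n (_ : y ^+ 2 = (1 - x) * (1 + x)); first by field.
      by rewrite (_ : y ^+ 2 = 1 - x ^+ 2); [ring | lra].
    have e' : 1 - (y / (1 + x)) ^+ 2 = 2 * x / (1 + x).
      rewrite (_ : _ ^+ 2 = 2 / (1 + x) - 1); first by field.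
      by rewrite -e; ring.
    rewrite /arc e e' (_ : 2 * x / (1 + x) / (2 / (1 + x)) = x); last by field.
    rewrite (_ : 2 * (y / (1 + x)) / (2 / (1 + x)) = y); last by field.
    by rewrite {1}(turn_basis u hv) addrC.
  by apply/eqP; rewrite eq_le !g_cst.
move=> u w hu hw; have [e|] := eqVneq (1 + dot w u) 0; last exact: near.
have wu : u = - w.
  have E : dot (u + w) (u + w) = 0.
    have -> : dot (u + w) (u + w) = dot u u + dot w w + 2 * dot w u.
      by rewrite /dot /=; ring.
    by rewrite hu hw; lra.
  have : u + w = 0.
    move: E; case: (u + w) => a b /eqP; rewrite /dot /= -!expr2 paddr_eq0 ?sqr_ge0 //.
    by rewrite !sqrf_eq0 => /andP[/eqP -> /eqP ->].
  by move/eqP; rewrite addr_eq0 => /eqP.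
have ht : dot (turn w) (turn w) = 1 by rewrite -hw /dot /turn /=; ring.
(* The pole - w is reached from w through the orthogonal vector. *)
have wt : dot w (turn w) = 0 by rewrite /dot /turn /=; ring.
have tu : dot (turn w) u = 0 by rewrite wu /dot /turn /=; ring.
transitivity (f (turn w)).
  by apply: near; rewrite // tu addr0 oner_neq0.
by apply: near; rewrite // wt addr0 oner_neq0.
Qed.

(** * Bodies with constant sections and projections *)

Lemma diameter_geodesic (R : realType) (O v : R * R) : hplane O -> dot v v = 1 ->
  is_geodesic (chord O 0 v) /\ chord O 0 v O.
Proof.
move=> hO hv; split; first by apply: chord_geodesic; rewrite ?expr0n ?ltr01.
by split; rewrite // klein_origin // /dot /= !mulr0 addr0.
Qed.

Lemma section_mem (R : realType) (O : R * R) (K : set (R * R)) u s1 s2 x r :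
  dot u u = 1 -> section_ends O K u s1 s2 -> hplane x -> klein O x = scalev r u ->
  K x <-> s1 <= r <= s2.
Proof.
move=> hu [_ _ _ h] hx ex.
have Gx : chord O 0 u x by split; rewrite // ex dot_scalevr dot_turnl mulr0.
by have := h x Gx; rewrite ex dot_scalevr hu mulr1.
Qed.

Lemma section_point (R : realType) (O : R * R) (K : set (R * R)) u s1 s2 r :
  hplane O -> dot u u = 1 -> section_ends O K u s1 s2 -> s1 <= r <= s2 ->
  exists x, [/\ hplane x, klein O x = scalev r u & K x].
Proof.
move=> hO hu sec hr; have [h1 h2 h3 _] := sec; have /andP[r1 r2] := hr.
have r01 : -1 < r < 1 by apply/andP; split; lra.
have [hx ex _] := klein_inv_chord hO hu r01.
by exists (klein_inv O (scalev r u)); split=> //; apply/(section_mem hu sec hx ex).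
Qed.

(** The end points of the section belong to K and are their own projections.
*)
Lemma section_shadow (R : realType) (O : R * R) (K : set (R * R)) u s1 s2 t1 t2 :
  hplane O -> dot u u = 1 -> section_ends O K u s1 s2 -> shadow_ends O K u t1 t2 ->
  t1 <= s1 /\ s2 <= t2.
Proof.
move=> hO hu sec [_ _ h _ _]; have [_ s12 _ _] := sec.
have [|y1 [_ e1 /h/andP[b1 _]]] := section_point hO hu sec (r := s1).
  by rewrite lexx.
have [|y2 [_ e2 /h/andP[_ b2]]] := section_point hO hu sec (r := s2).
  by rewrite s12 lexx.
by move: b1 b2; rewrite e1 e2 !dot_scalevr hu !mulr1.
Qed.

(** As the hyperbolic abscissa is increasing, an interval that extends further
at one end is hyperbolically longer. *)
Lemma arc_pos_spread_inj (R : realType) (s1 s2 t1 t2 : R) :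
  -1 < t1 -> t2 < 1 -> t1 <= s1 -> s1 <= s2 -> s2 <= t2 ->
  arc_pos 1 t2 - arc_pos 1 t1 = arc_pos 1 s2 - arc_pos 1 s1 -> t2 = s2.
Proof.
move=> h1 h2 h3 h4 h5 e.
have it1 : - 1 < t1 < 1 by apply/andP; split; lra.
have it2 : - 1 < t2 < 1 by apply/andP; split; lra.
have is1 : - 1 < s1 < 1 by apply/andP; split; lra.
have is2 : - 1 < s2 < 1 by apply/andP; split; lra.
apply: (arc_pos_inj it2 is2); apply/eqP; rewrite eq_le.
move: h3 h5; rewrite -(ler_arc_pos it1 is1) -(ler_arc_pos is2 it2) => b1 b2.
by apply/andP; split; lra.
Qed.

(** Constancy of the section lengths makes F (b u) largest exactly where - F
(a u) is smallest.  So in the direction v of a farthest point of K, the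
opposite end a v is the end closest to O among those in all directions. *)
Lemma equichordal_extremes (R : realType) (O : R * R) (K : set (R * R))
    (a b : R * R -> R) (l : R) :
  hplane O -> K `<=` @hplane R -> compact K -> interior K O ->
  (forall u, dot u u = 1 -> section_ends O K u (a u) (b u)) ->
  (forall u, dot u u = 1 -> arc_pos 1 (b u) - arc_pos 1 (a u) = l) ->
  exists v, [/\ dot v v = 1, a v < 0,
    (forall x, K x -> dot (klein O x) (klein O x) <= b v ^+ 2) &
    forall u, dot u u = 1 -> a u <= a v /\ - a v <= b u].
Proof.
move=> hO hK cK IO sec len.
have [x0 /set_mem Kx0 maxx0] : exists2 x0, x0 \in K &
    forall x, x \in K -> dot (klein O x) (klein O x) <= dot (klein O x0) (klein O x0).
  apply: compact_EVT_max => //; first by exists O; exact: interior_subset IO.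
  by apply: continuous_in_subspaceT => x /set_mem Kx; exact: sqr_klein_cvg hO (hK _ Kx).
have [v hv] := polar_decomposition (klein O x0); set M := Num.sqrt _ => ex0.
have M0 : 0 <= M by exact: sqrtr_ge0.
have KM x : K x -> dot (klein O x) (klein O x) <= M ^+ 2.
  by move=> Kx; rewrite sqr_sqrtr ?dot_ge0 // maxx0 // inE.
have rM u r : dot u u = 1 -> a u <= r <= b u -> - M <= r <= M.
  move=> hu hr; apply: sqr_itv => //.
  have [x [_ ex Kx]] := section_point hO hu (sec u hu) hr.
  by have := KM x Kx; rewrite ex dot_scalev hu mulr1.
have [v1 v2 v3 v4] := sec v hv.
have bM : b v = M.
  apply/eqP; rewrite eq_le; apply/andP; split.
    by have /andP[] := rM v (b v) hv ltac:(by rewrite v2 lexx).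
  by have /(section_mem hv (sec v hv) (hK _ Kx0) ex0)/andP[] := Kx0.
have av0 : a v < 0.
  have [e [y [e0 Ky Gy]]] := interior_chord (-1) hO hv (diameter_geodesic hO hv).2 IO.
  rewrite klein_origin // {2}/dot /= !mulr0 addr0 add0r mulrN1 => ey.
  by have /(v4 _ Gy) := Ky; rewrite ey => /andP[h1 _]; lra.
clearbody M; exists v; split=> //; first by rewrite bM.
move=> u hu; have [u1 u2 u3 _] := sec u hu.
have /andP[p1 p2] := rM u (a u) hu ltac:(by rewrite u2 lexx).
have /andP[q1 q2] := rM u (b u) hu ltac:(by rewrite u2 lexx).
have /andP[r1 r2] := rM v (a v) hv ltac:(by rewrite v2 lexx).
have M1 : M < 1 by rewrite -bM.
have lu := len u hu; have := len v hv; rewrite bM -lu => lv.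
have i1 r : - M <= r -> r <= M -> - 1 < r < 1.
  by move=> *; apply/andP; split; lra.
have iM : -1 < M < 1 by apply: i1 => //; lra.
have iNM : -1 < - M < 1 by apply: i1 => //; lra.
have iNa : -1 < - a v < 1 by apply: i1; lra.
have h1 : arc_pos 1 (b u) <= arc_pos 1 M by rewrite (ler_arc_pos (i1 _ q1 q2) iM).
have h2 : arc_pos 1 (- M) <= arc_pos 1 (a u) by rewrite (ler_arc_pos iNM (i1 _ p1 p2)).
rewrite -(ler_arc_pos (i1 _ p1 p2) (i1 _ r1 r2)) -(ler_arc_pos iNa (i1 _ q1 q2)).
by move: h2; rewrite !arc_posN => h2; split; lra.
Qed.

(** Along each diameter hyperbolic distance to O increases with the Euclidean
norm. *)
Lemma central_disc (R : realType) (O : R * R) (K : set (R * R)) (M : R)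
    (a : R * R -> R) :
  hplane O -> K `<=` @hplane R -> 0 < M -> M < 1 ->
  (forall u, dot u u = 1 -> section_ends O K u (a u) M) ->
  (forall u, dot u u = 1 -> a u <= 0) -> K = hdisc O (arc_pos 1 M).
Proof.
move=> hO hK M0 M1 sec a0.
apply/seteqP; split=> x; [move=> Kx; have hx := hK _ Kx; split=> //; move: Kx |
  move=> [hx]].
all: rewrite hdist_origin //; have [u hu] := polar_decomposition (klein O x).
all: set r := Num.sqrt _ => er; have r0 : 0 <= r by exact: sqrtr_ge0.
all: have hr : -1 < r < 1.
1,3: have Gx : chord O 0 u x by split; rewrite // er dot_scalevr dot_turnl mulr0.
1,2: by have := diameter_coord hO hu Gx; rewrite er dot_scalevr hu mulr1.
all: have iM : -1 < M < 1 by apply/andP; split; lra.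
all: rewrite ler_arc_pos // => h.
  by have /(section_mem hu (sec u hu) hx er)/andP[] := h.
apply/(section_mem hu (sec u hu) hx er); rewrite h andbT.
exact: le_trans (a0 u hu) r0.
Qed.

Theorem theorem4p7 (R : realType) (O : R * R) (hO : hplane O)
    (K : set (R * R)) (hbody : is_body K) (hconv : hconvex K)
    (hOK : interior K O) (hC1 : C1_smooth_closed_curve (boundary K))
    (c1 c2 : R)
    (hsec : forall G : set (R * R), is_geodesic G -> G O ->
       has_length (K `&` G) c1)
    (hproj : forall G : set (R * R), is_geodesic G -> G O ->
       has_length (projection G K) c2) :
  is_disc K /\ c1 = c2.
Proof.
have [hK cK _ _] := hbody.
have [s hs] : {s : R * R -> R * R | forall u, dot u u = 1 ->
    section_ends O K u (s u).1 (s u).2 /\ arc_pos 1 (s u).2 - arc_pos 1 (s u).1 = c1}.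
  suff /choice[s hs] : forall u, exists p : R * R, dot u u = 1 ->
    section_ends O K u p.1 p.2 /\ arc_pos 1 p.2 - arc_pos 1 p.1 = c1 by exists s.
  move=> u; have [hu|/eqP n] := eqVneq (dot u u) 1; last by exists (0, 0) => /n.
  have [G1 G2] := diameter_geodesic hO hu.
  by have [s1 [s2 h]] := section_endsP hO hu (hsec _ G1 G2); exists (s1, s2).
have shadow u : dot u u = 1 -> exists t1 t2,
    shadow_ends O K u t1 t2 /\ arc_pos 1 t2 - arc_pos 1 t1 = c2.
  move=> hu; have [G1 G2] := diameter_geodesic hO hu.
  exact: shadow_endsP hO hu hK (hproj _ G1 G2).
pose a u := (s u).1; pose b u := (s u).2.
have sec u : dot u u = 1 -> section_ends O K u (a u) (b u) by move=> /hs[].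
have len u : dot u u = 1 -> arc_pos 1 (b u) - arc_pos 1 (a u) = c1 by move=> /hs[].
clearbody a b; clear s hs.
have [v [hv av0 KM near_far]] := equichordal_extremes hO hK cK hOK sec len.
set M := b v in KM; set m := - a v; have m0 : 0 < m by rewrite oppr_gt0.
have [v1 v2 v3 v4] := sec v hv.
have mM : m <= M by case: (near_far v hv).
have M0 : 0 < M by exact: lt_le_trans mM.
have ball z : hplane z -> dot (klein O z) (klein O z) < m ^+ 2 -> K z.
  move=> hz /ltW hzm; have [u hu] := polar_decomposition (klein O z).
  set r := Num.sqrt _ => er.
  have r0 : 0 <= r by exact: sqrtr_ge0.
  have [h1 h2] := near_far u hu; apply/(section_mem hu (sec u hu) hz er).
  have /andP[_ h] : - m <= r <= m.
    by apply: sqr_itv; [exact: ltW | rewrite sqr_sqrtr ?dot_ge0].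
  rewrite (le_trans h h2) andbT (le_trans h1) //.
  exact: le_trans (ltW av0) r0.
have le_v y : K y -> - m <= dot v (klein O y).
  move=> Ky; have [|p [hp ep Kp]] := section_point hO hv (sec v hv) (r := a v).
    by rewrite lexx.
  have hNv : dot (scalev (-1) v) (scalev (-1) v) = 1 by rewrite dot_scalev hv; ring.
  have eNv : dot (scalev (-1) v) (klein O y) = - dot v (klein O y).
    by rewrite dotC (dot_scalevr (-1)) mulN1r dotC.
  have epN : klein O p = scalev m (scalev (-1) v).
    by rewrite ep /m /scalev /=; congr pair; ring.
  rewrite lerNl -eNv; apply: (nearest_support hO hK cK hconv hNv m0 Kp _ epN) => //.
  have Gp : chord O 0 v p by split; rewrite // ep dot_scalevr dot_turnl mulr0.
  move=> pI; have [e [z [e0 Kz Gz ez]]] := interior_chord (-1) hO hv Gp pI.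
  have /(v4 _ Gz)/andP[+ _] := Kz.
  by rewrite ez ep dot_scalevr hv; lra.
(* In the direction v the projection has the same ends as the section. *)
have c12 : c1 = c2.
  have [t1 [t2 [sh <-]]] := shadow v hv.
  have [h1 h2] := section_shadow hO hv (sec v hv) sh.
  have [_ _ _ [y1 Ky1 e1] [y2 Ky2 e2]] := sh.
  have -> : t1 = a v.
    by apply/eqP; rewrite eq_le h1 -e1 -[leLHS]opprK le_v.
  have -> : t2 = b v; last by rewrite len.
  apply/eqP; rewrite eq_le h2 andbT -e2.
  have /andP[//] : - M <= dot v (klein O y2) <= M.
  apply: sqr_itv (ltW M0) _; apply: le_trans (KM _ Ky2).
  by rewrite -[leRHS]mul1r -hv cauchy_schwarz.
split=> //.
(* Equality of both lengths makes sections and projections coincide. *)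
have support u x : dot u u = 1 -> K x -> dot u (klein O x) <= b u.
  move=> hu Kx; have [t1 [t2 [sh l2]]] := shadow u hu.
  have [h1 h2] := section_shadow hO hu (sec u hu) sh.
  have [_ u2 _ _] := sec u hu; have [i1 i2 h _ _] := sh.
  have <- : t2 = b u.
    by apply: (arc_pos_spread_inj i1 i2 h1 u2 h2); rewrite l2 len.
  by have /andP[] := h _ Kx.
have bE u : dot u u = 1 -> b u = M.
  move=> hu; apply: (support_radial_cst _ _ hu hv) => [w hw|w1 w2 hw1 hw2].
    have [_ h] := near_far w hw; have [_ _ h' _] := sec w hw.
    by rewrite (le_trans (ltW m0) h) ltW.
  have [_ h _ _] := sec w2 hw2.
  have [|x [_ ex Kx]] := section_point hO hw2 (sec w2 hw2) (r := b w2).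
    by rewrite h lexx.
  by have := support w1 x hw1 Kx; rewrite ex dot_scalevr dotC.
exists O, (arc_pos 1 M); split=> //.
  by rewrite -(arc_pos0 1); apply: ltr_arc_pos => //; rewrite oppr_lt0.
apply: (central_disc (a := a)) => // u hu; first by rewrite -(bE u hu); exact: sec.
by have [h _] := near_far u hu; exact: le_trans h (ltW av0).
Qed.
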